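(* Let $n\in\mathbb{D}$ be squarefree with $n\equiv 1\pmod 4$, and let $L\subset\mathbb{Z}^4$ be a primitive two-dimensional sublattice with $\operatorname{disc}(Q_L)=-4n$. For $i=1,2$, the image of the linear map $\mu_i: L\otimes L^{\perp}\to\mathbf{B}_0(\mathbb{Z})$ is the two-dimensional lattice $M_i$, and $(M_i,Q_{M_i})$ is a Legendre composition of $(L,Q_L)$ and $(L^{\perp},Q_{L^{\perp}})$.
   Context: $\mathbb{D}=\{D\in\mathbb{N}:D\not\equiv 0,7,12,15\pmod{16}\}$. A two-dimensional sublattice $L\subset\mathbb{Z}^4$ is primitive if $(\mathbb{Q}L)\cap\mathbb{Z}^4=L$; $L^\perp=\{w\in\mathbb{Z}^4:\langle w,x\rangle=0\ \forall x\in L\}$ for the standard inner product. For a sublattice $N$, $Q_N$ is the restriction of the sum-of-squares form to $N$, and $\operatorname{disc}(Q_L)$ is $-4$ times the determinant of its Gram matrix. Identify $\mathbb{Z}^4$ with the integral Hamilton quaternions $\mathbf{B}(\mathbb{Z})$ via $(a,b,c,d)\mapsto a+b\mathbf{i}+c\mathbf{j}+d\mathbf{k}$, with conjugation $x\mapsto\bar x$, trace $\operatorname{Tr}(x)=x+\bar x$ and norm $\operatorname{Nr}(x)=x\bar x$ (the sum-of-squares form); $\mathbf{B}_0(\mathbb{Z})$ denotes trace-zero integral quaternions, identified with $\mathbb{Z}^3$ via $x\mathbf{i}+y\mathbf{j}+z\mathbf{k}\mapsto(x,y,z)$. For $L=\langle u,v\rangle$ (a $\mathbb{Z}$-basis)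 put $a_1(L)=u\bar v-\tfrac12\operatorname{Tr}(u\bar v)$ and $a_2(L)=\bar v u-\tfrac12\operatorname{Tr}(\bar v u)$, and $M_i=a_i(L)^{\perp}\subset\mathbb{Z}^3$ (orthogonal complement in $\mathbb{Z}^3$ for the standard inner product), with $Q_{M_i}$ the restriction of $x^2+y^2+z^2$. Define $\mu_1(v\otimes w)=v\bar w$ and $\mu_2(v\otimes w)=\bar v w$ for $v\in L$, $w\in L^\perp$, extended linearly. A binary quadratic lattice $(M,q_M)$ (a rank-2 lattice with integer-valued quadratic form) is a Legendre composition of binary quadratic lattices $(L,q_L)$, $(L',q_{L'})$ if there is a surjective linear homomorphism $\mu:L\otimes L'\to M$ with $q_L(u)q_{L'}(v)=q_M(\mu(u\otimes v))$ for all $u\in L,v\in L'$. *)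

(* Defs.v *)
From HB Require Import structures.
From mathcomp Require Import all_boot all_order all_algebra.
From mathcomp Require Import boolp.
From mathcomp Require Import ring.
From mathcomp Require Import freeg.

Set Implicit Arguments.
Unset Strict Implicit.
Unset Printing Implicit Defensive.

Import GRing.Theory.
Local Open Scope ring_scope.
Local Open Scope quotient_scope.

(* Sublattices of Z^n are additive subgroups, given as [zmodClosed]
   predicates; [sublattice L] is L as an abelian group in its own right. *)

Section Sublattice.
Variables (V : zmodType) (L : zmodClosed V).

Inductive sublattice : predArgType := Sublattice v & v \in L.

Definition slval (x : sublattice) : V := let: Sublattice v _ := x in v.

HB.instance Definition _ := [isSub of sublattice for slval].
HB.instance Definition _ := [Choice of sublattice by <:].
HB.instance Definition _ := [SubChoice_isSubZmodule of sublattice by <:].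

End Sublattice.

Definition zbasis2 (M : zmodType) (u v : M) : Prop :=
  forall x : M, exists! c : int * int, x = u *~ c.1 + v *~ c.2.

Definition zrank2 (M : zmodType) : Prop := exists u v : M, zbasis2 u v.

Definition dot n (x y : 'rV[int]_n) : int := \sum_i x 0 i * y 0 i.

Definition sumsq n (L : zmodClosed 'rV[int]_n) (x : sublattice L) : int :=
  dot (val x) (val x).
Arguments sumsq {n} L x.

Definition gram2 n (u v : 'rV[int]_n) : 'M[int]_2 :=
  \matrix_(i, j) dot [:: u; v]`_i [:: u; v]`_j.

(* The discriminant of the restricted form, computed in the basis (u, v); it
   does not depend on the choice of that basis. *)
Definition disc n (u v : 'rV[int]_n) : int := - 4 * \det (gram2 u v).

(* The elements of Z^n lying in the rational span of L. *)
Definition in_Qspan n (L : {pred 'rV[int]_n}) (x : 'rV[int]_n) : Prop :=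
  exists (m : nat) (c : 'I_m -> rat) (l : 'I_m -> 'rV[int]_n),
    (forall i, l i \in L) /\
    map_mx intr x = \sum_i c i *: map_mx intr (l i) :> 'rV[rat]_n.

Definition primitive n (L : {pred 'rV[int]_n}) : Prop :=
  forall x, in_Qspan L x <-> x \in L.

Section Orthogonal.
Variables (n : nat) (A : {pred 'rV[int]_n}).

Definition orth : {pred 'rV[int]_n} :=
  fun w => `[< forall x, x \in A -> dot w x = 0 >].

Lemma orth_zmod_closed : zmod_closed orth.
Proof.
split=> [|x y /asboolP xP /asboolP yP]; apply/asboolP => z zA.
  by rewrite /dot big1 // => i _; rewrite mxE mul0r.
transitivity (dot x z - dot y z); last by rewrite xP // yP // subr0.
by rewrite /dot -sumrB; apply: eq_bigr => i _; rewrite !mxE mulrBl.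
Qed.
HB.instance Definition _ :=
  GRing.isZmodClosed.Build 'rV[int]_n orth orth_zmod_closed.

End Orthogonal.

Definition biadditive (L L' V : zmodType) (f : L -> L' -> V) : Prop :=
  (forall u1 u2 v, f (u1 + u2) v = f u1 v + f u2 v) /\
  (forall u v1 v2, f u (v1 + v2) = f u v1 + f u v2).

(* The tensor product over Z: the free abelian group on L * L' modulo the
   subgroup generated by the biadditivity relations. *)

Section Tensor.
Variables L L' : zmodType.
Local Notation F := {freeg (L * L')}.
Local Notation gen u v := (<< (u, v) >> : F).

Inductive tensor_generator : F -> Prop :=
| TensorGenL u1 u2 v :
    tensor_generator (gen (u1 + u2) v - gen u1 v - gen u2 v)
| TensorGenR u v1 v2 :
    tensor_generator (gen u (v1 + v2) - gen u v1 - gen u v2).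

Definition tensor_relations : {pred F} := fun x =>
  `[< forall S : zmodClosed F, (forall y, tensor_generator y -> y \in S) ->
      x \in S >].

Lemma tensor_relations_zmod_closed : zmod_closed tensor_relations.
Proof.
split=> [|x y /asboolP xP /asboolP yP]; apply/asboolP => S SP.
  exact: rpred0.
by rewrite rpredB ?xP ?yP.
Qed.
HB.instance Definition _ :=
  GRing.isZmodClosed.Build F tensor_relations tensor_relations_zmod_closed.

Definition tensor := Quotient.quot tensor_relations.
HB.instance Definition _ := GRing.Zmodule.on tensor.

Definition tens (u : L) (v : L') : tensor := \pi_tensor (gen u v).

(* The linear extension of [u (x) v |-> f u v]; only meaningful when f is
   biadditive, see [tensor_lift_tens] and [tensor_lift_additive]. *)
Definition tensor_lift (V : zmodType) (f : L -> L' -> V) (t : tensor) : V :=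
  fglift ((fun p => f p.1 p.2) : L * L' -> zmodule V) (repr t).

Section TensorLift.
Variables (V : zmodType) (f : L -> L' -> V) (f_bi : biadditive f).

Let lift0 : F -> zmodule V :=
  fglift ((fun p => f p.1 p.2) : L * L' -> zmodule V).

Let lift0B : {morph lift0 : x y / x - y}.
Proof. exact: lift_is_additive. Qed.

Let lift0_relations x : x \in tensor_relations -> lift0 x = 0.
Proof.
pose K : {pred F} := fun y => lift0 y == 0.
have K_closed : zmod_closed K.
  split=> [|y z /eqP yK /eqP zK]; apply/eqP; last by rewrite lift0B yK zK subr0.
  by rewrite -(subrr 0) lift0B subrr.
pose K_mixin := GRing.isZmodClosed.Build F K K_closed.
pose KZ : zmodClosed F := HB.pack K K_mixin.
move=> /asboolP /(_ KZ) xK; apply/eqP; apply: xK => y [u1 u2 v|u v1 v2].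
  apply/eqP; rewrite !lift0B /lift0 !liftU !scale1r /=.
  by rewrite f_bi.1 addrAC addrK subrr.
apply/eqP; rewrite !lift0B /lift0 !liftU !scale1r /=.
by rewrite f_bi.2 addrAC addrK subrr.
Qed.

Let tensor_lift_pi x : tensor_lift f (\pi_tensor x) = lift0 x.
Proof.
apply/eqP; rewrite -subr_eq0; apply/eqP.
rewrite -[tensor_lift f _]/(lift0 _) -lift0B.
by apply: lift0_relations; rewrite Quotient.idealrBE reprK.
Qed.

Lemma tensor_lift_tens u v : tensor_lift f (tens u v) = f u v.
Proof. by rewrite tensor_lift_pi /lift0 liftU scale1r. Qed.

Lemma tensor_lift_additive : zmod_morphism (tensor_lift f).
Proof.
move=> x y; rewrite -[x]reprK -[y]reprK -raddfB /= !tensor_lift_pi.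
exact: lift0B.
Qed.

End TensorLift.

End Tensor.

(* (M, q) is a rank-2 lattice with an integer-valued quadratic form. *)
Definition binary_quadratic_lattice (M : zmodType) (q : M -> int) : Prop :=
  [/\ zrank2 M,
      forall (k : int) (x : M), q (x *~ k) = k ^+ 2 * q x
    & biadditive (fun x y => q (x + y) - q x - q y)].

Definition legendre_composition (M L L' : zmodType)
    (qM : M -> int) (qL : L -> int) (qL' : L' -> int) : Prop :=
  [/\ binary_quadratic_lattice qM,
      binary_quadratic_lattice qL,
      binary_quadratic_lattice qL'
    & exists2 mu : {additive tensor L L' -> M},
        forall m, exists t, mu t = m
        & forall u v, qL u * qL' v = qM (mu (tens u v))].

(* Integral Hamilton quaternions a + b i + c j + d k, identified with Z^4. *)

Definition quat (a b c d : int) : 'rV[int]_4 := \row_i [:: a; b; c; d]`_i.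

Definition qmul (x y : 'rV[int]_4) : 'rV[int]_4 :=
  quat (x 0 0 * y 0 0 - x 0 1 * y 0 1 - x 0 2 * y 0 2 - x 0 3 * y 0 3)
       (x 0 0 * y 0 1 + x 0 1 * y 0 0 + x 0 2 * y 0 3 - x 0 3 * y 0 2)
       (x 0 0 * y 0 2 - x 0 1 * y 0 3 + x 0 2 * y 0 0 + x 0 3 * y 0 1)
       (x 0 0 * y 0 3 + x 0 1 * y 0 2 - x 0 2 * y 0 1 + x 0 3 * y 0 0).

Lemma qmulDl x y z : qmul (x + y) z = qmul x z + qmul y z.
Proof.
apply/rowP => i; rewrite !mxE /=.
by case: i => [[|[|[|[|i]]]] ?] //=; ring.
Qed.

Lemma qmulDr x y z : qmul x (y + z) = qmul x y + qmul x z.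
Proof.
apply/rowP => i; rewrite !mxE /=.
by case: i => [[|[|[|[|i]]]] ?] //=; ring.
Qed.

Definition qconj (x : 'rV[int]_4) : 'rV[int]_4 :=
  quat (x 0 0) (- x 0 1) (- x 0 2) (- x 0 3).

Lemma qconjD x y : qconj (x + y) = qconj x + qconj y.
Proof.
apply/rowP => i; rewrite !mxE /=.
by case: i => [[|[|[|[|i]]]] ?] //=; ring.
Qed.

Definition qtr (x : 'rV[int]_4) : int := (x + qconj x) 0 0.

(* x - Tr(x)/2; the division is exact because traces of integral quaternions
   are even. *)
Definition qpure (x : 'rV[int]_4) : 'rV[int]_4 :=
  x - quat (qtr x %/ 2)%Z 0 0 0.

(* x i + y j + z k |-> (x, y, z), to be used on trace-zero quaternions. *)
Definition qvec (x : 'rV[int]_4) : 'rV[int]_3 :=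
  \row_i [:: x 0 1; x 0 2; x 0 3]`_i.

Definition a1 (u v : 'rV[int]_4) : 'rV[int]_3 := qvec (qpure (qmul u (qconj v))).
Definition a2 (u v : 'rV[int]_4) : 'rV[int]_3 := qvec (qpure (qmul (qconj v) u)).

Section Mu.
Variable L : zmodClosed 'rV[int]_4.

Definition mu1 : tensor (sublattice L) (sublattice (orth L)) -> 'rV[int]_4 :=
  tensor_lift (fun v w => qmul (val v) (qconj (val w))).

Let mu1_biadditive : biadditive
  (fun (v : sublattice L) (w : sublattice (orth L)) => qmul (val v) (qconj (val w))).
Proof. by split=> *; rewrite !raddfD /= ?qconjD (qmulDl, qmulDr). Qed.

Lemma mu1_tens v w : mu1 (tens v w) = qmul (val v) (qconj (val w)).
Proof. exact: (tensor_lift_tens mu1_biadditive). Qed.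

Lemma mu1_additive : zmod_morphism mu1.
Proof. exact: (tensor_lift_additive mu1_biadditive). Qed.

Definition mu2 : tensor (sublattice L) (sublattice (orth L)) -> 'rV[int]_4 :=
  tensor_lift (fun v w => qmul (qconj (val v)) (val w)).

Let mu2_biadditive : biadditive
  (fun (v : sublattice L) (w : sublattice (orth L)) => qmul (qconj (val v)) (val w)).
Proof. by split=> *; rewrite !raddfD /= ?qconjD (qmulDl, qmulDr). Qed.

Lemma mu2_tens v w : mu2 (tens v w) = qmul (qconj (val v)) (val w).
Proof. exact: (tensor_lift_tens mu2_biadditive). Qed.

Lemma mu2_additive : zmod_morphism mu2.
Proof. exact: (tensor_lift_additive mu2_biadditive). Qed.

End Mu.

Arguments mu1 : clear implicits.
Arguments mu2 : clear implicits.

Definition in_D (n : nat) : bool := (n %% 16)%N \notin [:: 0; 7; 12; 15]%N.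

Definition squarefree (n : nat) : Prop :=
  forall d : nat, (d ^ 2 %| n)%N -> d = 1%N.

(* Main.v *)
(* Write N for the norm and c(x) for the conjugate of x.  For x in L and w in
   L^perp the product x c(w) has trace 2<x, w> = 0 and is orthogonal to a_1(L),
   so the image of mu_1 lies in M_1.  Conversely, if m is in M_1 and x in L then
   c(m) x lies in L^perp and x c(c(m) x) = N(x) m, so the image contains
   N(x) M_1 for every x in L.  The values of N on L generate the unit ideal: in
   terms of the Gram matrix [[a, b], [b, c]] of determinant n, a common divisor
   of a, c and a + 2b + c divides 2b; it is odd because -b^2 = n = 1 (mod 4) is
   impossible, hence it divides b and its square divides n.  The same works for
   mu_2 since a_2(u, v) = a_1(c(v), c(u)).  The ranks come from the Smith normal
   form. *)
From HB Require Import structures.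
Require Import Defs.
From mathcomp Require Import all_boot all_order all_algebra.
From mathcomp Require Import ring zify boolp freeg.

Set Implicit Arguments.
Unset Strict Implicit.
Unset Printing Implicit Defensive.

Import GRing.Theory Num.Theory.
Local Open Scope ring_scope.

(** * Bilinearity of the standard inner product *)

Lemma dot4E (x y : 'rV[int]_4) :
  dot x y = x 0 0 * y 0 0 + x 0 1 * y 0 1 + x 0 2 * y 0 2 + x 0 3 * y 0 3.
Proof.
rewrite /dot !big_ord_recl big_ord0 addr0 !addrA.
by do !congr (_ + _); congr (_ * _); congr (_ _ _); apply: val_inj.
Qed.

Lemma dot3E (x y : 'rV[int]_3) :
  dot x y = x 0 0 * y 0 0 + x 0 1 * y 0 1 + x 0 2 * y 0 2.
Proof.
rewrite /dot !big_ord_recl big_ord0 addr0 !addrA.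
by do !congr (_ + _); congr (_ * _); congr (_ _ _); apply: val_inj.
Qed.

Lemma dotC n (x y : 'rV[int]_n) : dot x y = dot y x.
Proof. by apply: eq_bigr => i _; rewrite mulrC. Qed.

Lemma dotDl n (x y z : 'rV[int]_n) : dot (x + y) z = dot x z + dot y z.
Proof. by rewrite -big_split; apply: eq_bigr => i _; rewrite mxE mulrDl. Qed.

Lemma dotDr n (x y z : 'rV[int]_n) : dot z (x + y) = dot z x + dot z y.
Proof. by rewrite !(dotC z) dotDl. Qed.

Lemma dotNl n (x y : 'rV[int]_n) : dot (- x) y = - dot x y.
Proof. by rewrite -sumrN; apply: eq_bigr => i _; rewrite mxE mulNr. Qed.

Lemma dotNr n (x y : 'rV[int]_n) : dot x (- y) = - dot x y.
Proof. by rewrite !(dotC x) dotNl. Qed.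

Lemma dotZl n (k : int) (x y : 'rV[int]_n) : dot (k *: x) y = k * dot x y.
Proof.
by rewrite /dot mulr_sumr; apply: eq_bigr => i _; rewrite mxE mulrA.
Qed.

(** The determinant condition makes the columns of [A] independent, so its Smith form [P D Q] has
    [k] nonzero diagonal entries. Then [x *m A = 0] exactly when the first [k] coordinates of
    [x *m P] vanish, and the last two rows of [invmx P] form a basis. *)
Lemma zrank2_ker k (A : 'M[int]_(k + 2, k)) (N : zmodClosed 'rV[int]_(k + 2)) :
  \det (A^T *m A) != 0 -> (forall x, x \in N <-> x *m A = 0) ->
  zrank2 (sublattice N).
Proof.
move=> detA NP.
have [P uP [Q uQ [d _ defA]]] := int_Smith_normal_form A.
set D := (X in P *m X *m Q) in defA.
(* If [d_j = 0], the [j]-th column [c] of the inverse of [Q] is killed by [A]. Multiplying by the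
   adjugate of [A^T A] gives [det(A^T A) c = 0], so [c = 0], although [Q c] is a unit vector. *)
have d_neq0 (j : 'I_k) : d`_j != 0.
  apply: contra detA => /eqP dj0.
  pose c : 'cV[int]_k := invmx Q *m delta_mx j 0.
  have Ac : A *m c = 0.
    rewrite defA -mulmxA mulKVmx // -mulmxA -colE.
    have -> : col j D = 0; last by rewrite mulmx0.
    apply/colP => i; rewrite !mxE; case: eqP => [->|//]; exact: dj0.
  have: \det (A^T *m A) *: c = 0.
    by rewrite -mul_scalar_mx -mul_adj_mx -!mulmxA Ac !mulmx0.
  move/eqP; rewrite scalemx_eq0 => /orP[//|/eqP c0].
  have /(congr1 (mulmx Q)) := c0; rewrite mulKVmx // mulmx0.
  by move/matrixP/(_ j 0)/eqP; rewrite !mxE !eqxx.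
have mulD (y : 'rV[int]_(k + 2)) j : (y *m D) 0 j = y 0 (lshift 2 j) * d`_j.
  rewrite mxE (bigD1 (lshift 2 j)) //= big1 ?addr0 => [|i /negPf ne].
    by rewrite mxE eqxx.
  by rewrite mxE -[_ == _ :> nat]/(i == lshift 2 j) ne mulr0.
have NE x : x \in N <-> lsubmx (x *m P) = 0.
  rewrite NP; split=> [xA|xP].
    have xPD : x *m P *m D = 0.
      by apply: (can_inj (mulmxK uQ)); rewrite mul0mx -xA defA !mulmxA.
    apply/rowP => j; have /rowP/(_ j)/eqP := xPD.
    by rewrite mulD !mxE mulf_eq0 (negPf (d_neq0 j)) orbF => /eqP.
  rewrite defA !mulmxA; suff -> : x *m P *m D = 0 by rewrite mul0mx.
  apply/rowP => j; rewrite mulD [RHS]mxE.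
  by have /rowP/(_ j) := xP; rewrite [LHS]mxE => ->; rewrite mxE mul0r.
pose b (i : 'I_2) : 'rV[int]_(k + 2) := row_mx 0 (delta_mx 0 i) *m invmx P.
have bN i : b i \in N by apply/NE; rewrite mulmxKV // row_mxKl.
exists (Sublattice (bN 0)), (Sublattice (bN 1)) => x.
have combP (c : int * int) :
    x = Sublattice (bN 0) *~ c.1 + Sublattice (bN 1) *~ c.2 <->
    rsubmx (val x *m P) = \row_i [:: c.1; c.2]`_i.
  have -> : \row_i [:: c.1; c.2]`_i =
      c.1 *: delta_mx 0 0 + c.2 *: delta_mx 0 1 :> 'rV[int]_2.
    by apply/rowP => -[[|[|]] ?] //; rewrite !mxE /= ?(mulr1, mulr0, addr0, add0r).
  have valE : val (Sublattice (bN 0) *~ c.1 + Sublattice (bN 1) *~ c.2) *m P =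
      row_mx 0 (c.1 *: delta_mx 0 0 + c.2 *: delta_mx 0 1).
    rewrite raddfD !raddfMz /= mulmxDl -!scaler_int !intz -!scalemxAl !mulmxKV //.
    by rewrite !scale_row_mx add_row_mx !scaler0 addr0.
  split=> [->|xE]; first by rewrite valE row_mxKr.
  apply: val_inj; apply: (can_inj (mulmxK uP)); rewrite valE -xE.
  by have /NE {1}<- := valP x; rewrite hsubmxK.
exists ((val x *m P) 0 (rshift k 0), (val x *m P) 0 (rshift k 1)); split.
  apply/combP/rowP => -[[|[|]] i2] //; rewrite mxE [RHS]mxE /=;
  by congr (_ _ _); apply: val_inj.
case=> c1 c2 /combP/rowP xE; have := xE 0; have := xE 1.
by rewrite [LHS]mxE [RHS]mxE /= => ->; rewrite [LHS]mxE [RHS]mxE /= => ->.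
Qed.

(** A representative in the free group turns the value into a finite sum of integer multiples of
    values of [f]; scaling in [zmodule V] is [*~]. *)
Lemma tensor_lift_closed (L L' V : zmodType) (S : zmodClosed V)
    (f : L -> L' -> V) (t : tensor L L') :
  (forall u v, f u v \in S) -> tensor_lift f t \in S.
Proof.
move=> fS; rewrite /tensor_lift -(freeg_repr (repr t)) fglift_Freeg.
apply: rpred_sum => z _.
by rewrite -[_ *: _]/(_ *~ _) rpredMz.
Qed.

(** The three combined numbers are the values of the form with Gram matrix [[[a, b], [b, c]]] at two
    basis vectors and at their sum. *)
Lemma coprime_values n (a b c : int) : squarefree n -> (n = 1 %[mod 4])%N ->
  a * c - b ^+ 2 = n%:Z ->
  exists x y z : int, x * a + y * c + z * (a + b *+ 2 + c) = 1.
Proof.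
move=> sqf n1 nE.
set g := gcdz a (gcdz c (b *+ 2)).
have ga : (g %| a)%Z by exact: dvdz_gcdl.
have gc : (g %| c)%Z by exact: dvdz_trans (dvdz_gcdr _ _) (dvdz_gcdl _ _).
have gb : (g %| b * 2)%Z.
  by rewrite mulr_natr; exact: dvdz_trans (dvdz_gcdr _ _) (dvdz_gcdr _ _).
have g2 : coprimez g 2.
  rewrite coprimez_sym coprimezE prime_coprime //; apply/negP => g2.
  have {g2} g2 : (2 %| g)%Z by [].
  have /dvdzP[a' a'E] := dvdz_trans g2 ga.
  have /dvdzP[c' c'E] := dvdz_trans g2 gc.
  move: nE n1; rewrite a'E c'E.
  have [b' bE] : exists b' : int, b = b' * 2 \/ b = b' * 2 + 1.
    by exists (b %/ 2)%Z; lia.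
  case: bE => ->; rewrite expr2; last nia.
  nia.
have {}gb : (g %| b)%Z by rewrite (Gauss_dvdzl _ g2) in gb.
have g1 : g = 1.
  suff g1 : `|g|%N = 1%N by rewrite -[g]/(`|g|%N%:Z) g1.
  apply: sqf; rewrite -abszX.
  have: (g ^+ 2 %| n%:Z)%Z.
    by rewrite -nE rpredB // ?expr2 ?dvdz_mul.
  by [].
have [x1 [y1 e1]] := Bezoutz a (gcdz c (b *+ 2)).
have [x2 [y2 e2]] := Bezoutz c (b *+ 2).
(* Nested Bezout relations give [g = x1 a + y1 x2 c + y1 y2 (2b)]; substitute
   [2b = (a + 2b + c) - a - c]. *)
exists (x1 - y1 * y2), (y1 * x2 - y1 * y2), (y1 * y2).
rewrite -g1 /g -e1 -e2 -mulr_natr; ring.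
Qed.

(** * Sublattices with a basis, orthogonal complements and their ranks *)

Lemma zbasis2_span n (L : zmodClosed 'rV[int]_n) (u v : sublattice L) x :
  zbasis2 u v -> x \in L -> exists c1 c2, x = c1 *: val u + c2 *: val v.
Proof.
move=> uv xL; have [[c1 c2] [/= xE _]] := uv (Sublattice xL).
exists c1, c2; transitivity (val u *~ c1 + val v *~ c2).
  by rewrite -!raddfMz -raddfD -xE.
by rewrite -!scaler_int !intz.
Qed.

Lemma mem_orth_zbasis2 n (L : zmodClosed 'rV[int]_n) (u v : sublattice L) w :
  zbasis2 u v -> (w \in orth L) <-> dot w (val u) = 0 /\ dot w (val v) = 0.
Proof.
move=> uv; split=> [/asboolP wL|[wu wv]].
  by split; apply: wL; exact: valP.
apply/asboolP => x /(zbasis2_span uv)[c1 [c2 ->]].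
by rewrite dotC dotDl !dotZl !(dotC _ w) wu wv !mulr0.
Qed.

Lemma mem_orth1 n (a x : 'rV[int]_n) : (x \in orth (pred1 a)) <-> dot x a = 0.
Proof.
split=> [/asboolP xa|xa]; last by apply/asboolP => _ /eqP->.
by apply: xa; rewrite inE.
Qed.

(** This is the kernel of the column [a^T], whose Gram determinant is [dot a a]. *)
Lemma zrank2_orth1 (a : 'rV[int]_3) :
  dot a a != 0 -> zrank2 (sublattice (orth (pred1 a))).
Proof.
have dotE (x y : 'rV[int]_3) : x *m y^T = (dot x y)%:M.
  rewrite [LHS]mx11_scalar; congr _%:M; rewrite mxE.
  by apply: eq_bigr => i _; rewrite mxE.
move=> a0; apply: (@zrank2_ker 1 a^T); first by rewrite trmxK dotE det_scalar1.
move=> x; rewrite mem_orth1 dotE; split=> [->|]; first by rewrite raddf0.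
by move/matrixP/(_ 0 0); rewrite !mxE.
Qed.

Lemma zrank2_orth (L : zmodClosed 'rV[int]_4) (u v : sublattice L) :
  zbasis2 u v -> \det (gram2 (val u) (val v)) != 0 ->
  zrank2 (sublattice (orth L)).
Proof.
move=> uv det0; pose A : 'M[int]_(2, 4) := \matrix_(i < 2) [:: val u; val v]`_i.
have AE w i : (w *m A^T) 0 i = dot w [:: val u; val v]`_i.
  by rewrite mxE; apply: eq_bigr => j _; rewrite !mxE.
apply: (@zrank2_ker 2 A^T) => [|w].
  rewrite trmxK; suff -> : A *m A^T = gram2 (val u) (val v) by [].
  by apply/matrixP => i j; rewrite !mxE; apply: eq_bigr => k _; rewrite !mxE.
rewrite (mem_orth_zbasis2 _ uv); split=> [[wu wv]|wA].
  by apply/rowP => -[[|[|]] ?] //; rewrite AE mxE.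
by rewrite -(AE w 0) -(AE w 1) wA !mxE.
Qed.

Lemma binary_quadratic_lattice_sumsq n (L : zmodClosed 'rV[int]_n) :
  zrank2 (sublattice L) -> binary_quadratic_lattice (sumsq L).
Proof.
move=> L2; split=> // [k x|].
  by rewrite /sumsq raddfMz /= -scaler_int intz dotZl dotC dotZl expr2 mulrA.
have polarE (x y : sublattice L) :
    sumsq L (x + y) - sumsq L x - sumsq L y = dot (val x) (val y) *+ 2.
  by rewrite /sumsq raddfD /= dotDl !dotDr (dotC (val y) (val x)); ring.
by split=> *; rewrite !polarE raddfD /= ?dotDl ?dotDr mulrnDl.
Qed.

(** * Trace-zero quaternions and the composition criterion *)

Lemma qtrE x : qtr x = x 0 0 *+ 2.
Proof. by rewrite /qtr !mxE. Qed.

Lemma qtr0 x : qtr x = 0 <-> x 0 0 = 0.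
Proof. by rewrite qtrE; split=> [/eqP|->//]; rewrite mulrn_eq0 => /eqP. Qed.

Lemma qvecB : {morph qvec : x y / x - y}.
Proof. by move=> x y; apply/rowP => -[[|[|[|]]] ?] //; rewrite !mxE. Qed.

(** The copy of [M] inside the trace-zero quaternions. Being a subgroup of Z^4, it can serve as the
    target in [tensor_lift_closed]. *)
Definition pure_over (M : {pred 'rV[int]_3}) : {pred 'rV[int]_4} :=
  fun x => (qtr x == 0) && (qvec x \in M).

Lemma pure_overP M x : x \in pure_over M <-> qtr x = 0 /\ qvec x \in M.
Proof. by split=> [/andP[/eqP]|[xT xM]]; rewrite // unfold_in xT xM. Qed.

Lemma pure_over_zmod_closed (M : zmodClosed 'rV[int]_3) :
  zmod_closed (pure_over M).
Proof.
have qvec0 : qvec 0 = 0 by rewrite -(subrr 0) qvecB subrr.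
split=> [|x y /pure_overP[xT xM] /pure_overP[yT yM]]; apply/pure_overP.
  by rewrite qtrE qvec0 mxE rpred0.
split; last by rewrite qvecB rpredB.
by move: xT yT; rewrite !qtr0 !mxE => -> ->.
Qed.
HB.instance Definition _ (M : zmodClosed 'rV[int]_3) :=
  GRing.isZmodClosed.Build 'rV[int]_4 (pure_over M) (pure_over_zmod_closed M).

Lemma quat_qvec (m : 'rV[int]_3) : qvec (quat 0 (m 0 0) (m 0 1) (m 0 2)) = m.
Proof.
by apply/rowP => -[[|[|[|]]] ?] //; rewrite !mxE /=; congr (_ _ _); apply: val_inj.
Qed.

Lemma dot_qvec x y : dot (qvec x) (qvec y) = dot x y - x 0 0 * y 0 0.
Proof. by rewrite dot3E dot4E !mxE /=; ring. Qed.

(* [g] inverts [f] in its second argument up to the scalar [dot x x], so the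
   image of [f] contains [dot x x *: m] for every [x] in [L]; it is everything
   once these values of the form on [L] generate the unit ideal. *)
Lemma legendre_composition_mul (L : zmodClosed 'rV[int]_4)
    (M : zmodClosed 'rV[int]_3) (f g : 'rV[int]_4 -> 'rV[int]_4 -> 'rV[int]_4) :
  zrank2 (sublattice L) -> zrank2 (sublattice (orth L)) ->
  zrank2 (sublattice M) ->
  biadditive f ->
  (forall x y, dot (f x y) (f x y) = dot x x * dot y y) ->
  (forall x w, x \in L -> w \in orth L -> f x w \in pure_over M) ->
  (forall x m, x \in L -> m \in pure_over M -> g x m \in orth L) ->
  (forall x m, f x (g x m) = dot x x *: m) ->
  (exists x y z : sublattice L, exists c1 c2 c3,
     c1 * sumsq L x + c2 * sumsq L y + c3 * sumsq L z = 1) ->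
  let mu (t : tensor (sublattice L) (sublattice (orth L))) :=
    tensor_lift (fun v w => f (val v) (val w)) t in
  (forall x, (exists t, mu t = x) <-> (qtr x = 0 /\ qvec x \in M)) /\
  zrank2 (sublattice M) /\
  legendre_composition (sumsq M) (sumsq L) (sumsq (orth L)).
Proof.
move=> L2 L'2 M2 f_bi f_norm f_pure g_orth fgK values mu.
have fL_bi : biadditive
    (fun (v : sublattice L) (w : sublattice (orth L)) => f (val v) (val w)).
  by split=> *; rewrite !raddfD /= (f_bi.1, f_bi.2).
have mu_tens v w : mu (tens v w) = f (val v) (val w).
  exact: (tensor_lift_tens fL_bi).
pose muA : {additive tensor (sublattice L) (sublattice (orth L)) -> 'rV[int]_4} :=
  HB.pack mu (GRing.isZmodMorphism.Build _ _ mu (tensor_lift_additive fL_bi)).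
have mu_pure t : mu t \in pure_over M.
  by apply: tensor_lift_closed => v w; apply: f_pure; exact: valP.
have mu_surj x : x \in pure_over M -> exists t, mu t = x.
  move=> xM; have [v1 [v2 [v3 [c1 [c2 [c3 c_eq]]]]]] := values.
  have [T TE] : exists T : sublattice L -> tensor (sublattice L) (sublattice (orth L)),
      forall v, muA (T v) = sumsq L v *: x.
    exists (fun v => tens v (Sublattice (g_orth _ _ (valP v) xM))) => v.
    by rewrite [LHS]mu_tens /= fgK.
  exists (T v1 *~ c1 + T v2 *~ c2 + T v3 *~ c3).
  rewrite -[LHS]/(muA _) !raddfD !raddfMz !TE -!scaler_int !intz !scalerA.
  by rewrite -!scalerDl c_eq scale1r.
split=> [x|]; first split=> [[t <-]|/pure_overP /mu_surj //].
  exact/pure_overP.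
split=> //; split; try exact: binary_quadratic_lattice_sumsq.
(* A Legendre composition needs a map into [M] itself: [nu] is [mu] followed by [qvec]. *)
have muM t : qvec (mu t) \in M by have /pure_overP[] := mu_pure t.
pose nu t := Sublattice (muM t).
have nu_additive : zmod_morphism nu.
  by move=> s t; apply: val_inj; rewrite raddfB /= -qvecB -(raddfB muA).
pose nuA : {additive tensor (sublattice L) (sublattice (orth L)) -> sublattice M} :=
  HB.pack nu (GRing.isZmodMorphism.Build _ _ nu nu_additive).
exists nuA => /=.
  move=> m; pose x := quat 0 (val m 0 0) (val m 0 1) (val m 0 2).
  have [|t tx] := mu_surj x; last first.
    by exists t; apply: val_inj; rewrite /= tx quat_qvec.
  by apply/pure_overP; rewrite quat_qvec (valP m) qtr0 !mxE.
(* [qvec] drops only the real coordinate, which is 0 here, so the norm is unchanged. *)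
move=> v w; rewrite /sumsq /= dot_qvec mu_tens f_norm.
have /pure_overP[/qtr0 -> _] := f_pure _ _ (valP v) (valP w).
by rewrite mulr0 subr0.
Qed.

(** * Gram determinants and quaternion identities *)

Lemma det_gram2 n (u v : 'rV[int]_n) :
  \det (gram2 u v) = dot u u * dot v v - dot u v ^+ 2.
Proof.
rewrite (expand_det_row _ 0) !big_ord_recl big_ord0 /cofactor !det_mx11 !mxE /=.
by rewrite (dotC v u) expr1 expr0; ring.
Qed.

Lemma row4P (x y : 'rV[int]_4) :
  x 0 0 = y 0 0 -> x 0 1 = y 0 1 -> x 0 2 = y 0 2 -> x 0 3 = y 0 3 -> x = y.
Proof.
move=> e0 e1 e2 e3; apply/rowP => i.
have : i \in [:: 0; 1; 2; 3] by case: i => [[|[|[|[|]]]] ?].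
by rewrite !inE => /or4P[] /eqP->.
Qed.

Lemma qmulZl c x y : qmul (c *: x) y = c *: qmul x y.
Proof. by apply: row4P; rewrite !mxE /=; ring. Qed.

Lemma qmul_biadditive1 : biadditive (fun x w => qmul x (qconj w)).
Proof. by split=> *; rewrite ?qconjD (qmulDl, qmulDr). Qed.

Lemma qmul_biadditive2 : biadditive (fun x w => qmul (qconj x) w).
Proof. by split=> *; rewrite ?qconjD (qmulDl, qmulDr). Qed.

Lemma qconjK : involutive qconj.
Proof. by move=> x; apply: row4P; rewrite !mxE /= ?opprK. Qed.

Lemma qconjZ c x : qconj (c *: x) = c *: qconj x.
Proof. by apply: row4P; rewrite !mxE /= ?mulrN. Qed.

Lemma qconjM x y : qconj (qmul x y) = qmul (qconj y) (qconj x).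
Proof. by apply: row4P; rewrite !mxE /=; ring. Qed.

Lemma dot_qconj x y : dot (qconj x) (qconj y) = dot x y.
Proof. by rewrite !dot4E !mxE /= !mulrNN. Qed.

Lemma qmul2K x m : qmul (qconj x) (qmul x m) = dot x x *: m.
Proof. by rewrite dot4E; apply: row4P; rewrite !mxE /=; ring. Qed.

Lemma qmul1K x m : qmul x (qconj (qmul (qconj m) x)) = dot x x *: m.
Proof. by rewrite qconjM qconjK -{1}[x]qconjK qmul2K dot_qconj. Qed.

Lemma dot_qmull x y z : dot (qmul x y) z = dot y (qmul (qconj x) z).
Proof. by rewrite !dot4E !mxE /=; ring. Qed.

Lemma dot_qmulr x y z : dot (qmul x y) z = dot x (qmul z (qconj y)).
Proof. by rewrite !dot4E !mxE /=; ring. Qed.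

Lemma dot_qmul x y z : dot (qmul x y) (qmul x z) = dot x x * dot y z.
Proof. by rewrite dot_qmull qmul2K dotC dotZl dotC. Qed.

Lemma qmul_conj0 x y : qmul x (qconj y) 0 0 = dot x y.
Proof. by rewrite dot4E !mxE /=; ring. Qed.

Lemma qvec_qconj x : qvec (qconj x) = - qvec x.
Proof. by apply/rowP => -[[|[|[|]]] ?] //; rewrite !mxE. Qed.

Lemma qvecD : {morph qvec : x y / x + y}.
Proof. by move=> x y; apply/rowP => -[[|[|[|]]] ?] //; rewrite !mxE. Qed.

Lemma qvecZ c x : qvec (c *: x) = c *: qvec x.
Proof. by apply/rowP => -[[|[|[|]]] ?] //; rewrite !mxE. Qed.

Lemma qvec_qpure x : qvec (qpure x) = qvec x.
Proof.
by apply/rowP => -[[|[|[|]]] ?] //; rewrite !mxE /= subr0.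
Qed.

Lemma a1E u v : a1 u v = qvec (qmul u (qconj v)).
Proof. exact: qvec_qpure. Qed.

Lemma a2E u v : a2 u v = a1 (qconj v) (qconj u).
Proof. by rewrite a1E qconjK; exact: qvec_qpure. Qed.

Lemma a1_linear c1 c2 u v w :
  a1 (c1 *: u + c2 *: v) w = c1 *: a1 u w + c2 *: a1 v w.
Proof. by rewrite !a1E qmulDl !qmulZl qvecD !qvecZ. Qed.

Lemma a1C u v : a1 u v = - a1 v u.
Proof. by rewrite !a1E -qvec_qconj qconjM qconjK. Qed.

(** Right factors [c(v)] and [c(w)] multiplied by [u] have inner product [dot u u * dot v w];
    removing the real parts [dot u v] and [dot u w] leaves the formula. For [v = w] it is the Gram
    determinant. *)
Lemma dot_a1 u v w :
  dot (a1 u v) (a1 u w) = dot u u * dot v w - dot u v * dot u w.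
Proof. by rewrite !a1E dot_qvec dot_qmul dot_qconj !qmul_conj0. Qed.

Lemma a2C u v : a2 u v = - a2 v u.
Proof. by rewrite !a2E a1C. Qed.

Lemma a2_linear c1 c2 u v w :
  a2 (c1 *: u + c2 *: v) w = c1 *: a2 u w + c2 *: a2 v w.
Proof.
rewrite a2C [a2 u w]a2C [a2 v w]a2C !a2E qconjD !qconjZ a1_linear.
by rewrite opprD !scalerN.
Qed.

Lemma dot_a2 u v w :
  dot (a2 u v) (a2 u w) = dot u u * dot v w - dot u v * dot u w.
Proof. by rewrite a2C (a2C u) !a2E dotNl dotNr opprK dot_a1 !dot_qconj. Qed.

(** * A common treatment of [a1] and [a2] *)

Section AlternatingMap.
Variable a : 'rV[int]_4 -> 'rV[int]_4 -> 'rV[int]_3.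
Hypothesis a_linear : forall c1 c2 u v w,
  a (c1 *: u + c2 *: v) w = c1 *: a u w + c2 *: a v w.
Hypothesis aC : forall u v, a u v = - a v u.
Hypothesis dot_a : forall u v w,
  dot (a u v) (a u w) = dot u u * dot v w - dot u v * dot u w.
Variables (L : zmodClosed 'rV[int]_4) (u v : sublattice L).
Hypothesis uv : zbasis2 u v.

(** By linearity [x] may be taken to be [u] or [v]; every term of [dot_a] then contains the inner
    product of [w] with [u] or [v]. *)
Lemma dot_alternating_orth x w :
  x \in L -> w \in orth L -> dot (a x w) (a (val u) (val v)) = 0.
Proof.
move=> /(zbasis2_span uv)[c1 [c2 ->]] /(mem_orth_zbasis2 _ uv)[wu wv].
rewrite a_linear dotDl !dotZl dot_a [a (val u) _]aC dotC dotNr dot_a.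
by rewrite !(dotC _ w) wu wv !(mulr0, mul0r, subr0, oppr0, addr0).
Qed.

(** For [x = c1 u + c2 v] and [y = d1 u + d2 v], alternation gives
    [a x y = (c1 d2 - c2 d1) a u v]. *)
Lemma dot_alternating_sublattice m x y :
  dot m (a (val u) (val v)) = 0 -> x \in L -> y \in L -> dot m (a x y) = 0.
Proof.
move=> ma /(zbasis2_span uv)[c1 [c2 ->]] /(zbasis2_span uv)[d1 [d2 ->]].
have aa z : a z z = 0.
  by apply/eqP; have /eqP := aC z z; rewrite -addr_eq0 -mulr2n -scaler_nat
    scalemx_eq0.
rewrite a_linear ![a _ (_ + _)]aC !a_linear !aa [a (val v) (val u)]aC.
rewrite !(scaler0, addr0, add0r, scalerN, opprK, scalerA) -scalerBl.
by rewrite dotC dotZl dotC ma mulr0.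
Qed.

End AlternatingMap.

Theorem theorem7p4 (n : nat) (L : zmodClosed 'rV[int]_4) (u v : sublattice L)
    (n_D : in_D n) (n_sqf : squarefree n) (n_mod4 : (n = 1 %[mod 4])%N)
    (uv_basis : zbasis2 u v) (L_prim : primitive L)
    (L_disc : disc (val u) (val v) = - 4 * n%:Z) :
  let M1 : zmodClosed 'rV[int]_3 := orth (pred1 (a1 (val u) (val v))) in
  let M2 : zmodClosed 'rV[int]_3 := orth (pred1 (a2 (val u) (val v))) in
  ((forall x, (exists t, mu1 L t = x) <-> (qtr x = 0 /\ qvec x \in M1)) /\
   zrank2 (sublattice M1) /\
   legendre_composition (sumsq M1) (sumsq L) (sumsq (orth L))) /\
  ((forall x, (exists t, mu2 L t = x) <-> (qtr x = 0 /\ qvec x \in M2)) /\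
   zrank2 (sublattice M2) /\
   legendre_composition (sumsq M2) (sumsq L) (sumsq (orth L))).
Proof.
move=> M1 M2.
have det_n : \det (gram2 (val u) (val v)) = n%:Z by exact: (mulfI _ L_disc).
have n_neq0 : n%:Z != 0 by case: n n_mod4 {n_D n_sqf L_disc det_n}.
have L2 : zrank2 (sublattice L) by exists u, v.
have L'2 : zrank2 (sublattice (orth L)).
  by apply: zrank2_orth uv_basis _; rewrite det_n.
(* The squared length of [a1] is the Gram determinant [n], hence nonzero. *)
have M12 : zrank2 (sublattice M1).
  by apply: zrank2_orth1; rewrite dot_a1 -expr2 -det_gram2 det_n.
have M22 : zrank2 (sublattice M2).
  by apply: zrank2_orth1; rewrite dot_a2 -expr2 -det_gram2 det_n.
have values : exists x y z : sublattice L, exists c1 c2 c3,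
    c1 * sumsq L x + c2 * sumsq L y + c3 * sumsq L z = 1.
  have := det_n; rewrite det_gram2.
  move=> /(coprime_values n_sqf n_mod4)[c1 [c2 [c3 c_eq]]].
  exists u, v, (u + v), c1, c2, c3; rewrite -c_eq /sumsq raddfD /= dotDl !dotDr.
  by rewrite (dotC (val v) (val u)); ring.
split.
  apply: (legendre_composition_mul L2 L'2 M12 qmul_biadditive1
    (g := fun x m => qmul (qconj m) x)) => //.
  - by move=> x y; rewrite dot_qmul dot_qconj.
  - move=> x w xL wL; apply/pure_overP; rewrite mem_orth1 -a1E qtr0 qmul_conj0.
    split; first by move/asboolP: wL; rewrite dotC; apply.
    exact: (dot_alternating_orth a1_linear a1C dot_a1 uv_basis).
  (* Here [<c(m) x, y> = <m, x c(y)>]. As [m] has trace zero, only the vector part [a1 x y] counts,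
     and it is a multiple of [a1 u v]. *)
  - move=> x m xL /pure_overP[/qtr0 m0 /mem_orth1 ma]; apply/asboolP => y yL.
    have := dot_alternating_sublattice a1_linear a1C uv_basis ma xL yL.
    rewrite a1E dot_qvec m0 mul0r subr0 => <-.
    by rewrite dot_qmulr -dot_qconj qconjK qconjM qconjK.
  - exact: qmul1K.
apply: (legendre_composition_mul L2 L'2 M22 qmul_biadditive2 (g := qmul)) => //.
- by move=> x y; rewrite dot_qmul dot_qconj.
- move=> x w xL wL; apply/pure_overP; rewrite mem_orth1 qtr0.
  (* This form exposes the vector part as [a1 (c(x)) (c(w)) = a2 w x = - a2 x w]. *)
  have -> : qmul (qconj x) w = qmul (qconj x) (qconj (qconj w)).
    by rewrite qconjK.
  rewrite qmul_conj0 dot_qconj -a1E -a2E a2C dotNl.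
  split; first by move/asboolP: wL; rewrite dotC; apply.
  by rewrite (dot_alternating_orth a2_linear a2C dot_a2 uv_basis) ?oppr0.
(* Now [<x m, y> = <m, c(x) y>], and the vector part of [c(x) y] is [a2 y x]. *)
- move=> x m xL /pure_overP[/qtr0 m0 /mem_orth1 ma]; apply/asboolP => y yL.
  have := dot_alternating_sublattice a2_linear a2C uv_basis ma yL xL.
  by rewrite a2E a1E qconjK dot_qvec m0 mul0r subr0 dot_qmull.
- exact: qmul2K.
Qed.
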